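(* Let $\mathcal I$ be a proper free ideal on $\mathbb N_0$ and let $\mathbf u=(u_n)_{n\in\mathbb N_0}$ be a sequence in an abelian group $G$. (a) If $\tau$ is a Hausdorff group topology on $G$ and $(u_n)_{n\in\mathbb N_0\setminus I}$ is $\tau$-convergent to $0$ for some $I\in\mathcal I$, then $\mathbf u$ is a $T^{\mathcal I}$-sequence and the identity $\iota_I\colon(G,T^{\mathcal I}_{\mathbf u})\to(G,\tau)$ is continuous. In particular, $T^{\mathcal I}_{\mathbf u}\supseteq T_{(u_n)_{n\in\mathbb N_0\setminus I}}$. (b) Let $\mathcal I$ be, in addition, a $P$-ideal. Then $\mathbf u$ is a $T^{\mathcal I}$-sequence if and only if there exists $I\in\mathcal I$ such that $(u_n)_{n\in\mathbb N_0\setminus I}$ is a $T$-sequence. In this situation the identity $\iota_I\colon(G,T^{\mathcal I}_{\mathbf u})\to(G,T_{(u_n)_{n\in\mathbb N_0\setminus I}})$ is continuous.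
   Context: $\mathbb N_0=\{0,1,2,\dots\}$. An ideal $\mathcal I$ on $\mathbb N_0$ is a nonempty family of subsets of $\mathbb N_0$ closed under taking subsets and finite unions; it is free if it contains all finite subsets of $\mathbb N_0$, proper if $\mathcal I\ne\mathcal P(\mathbb N_0)$, and a $P$-ideal if for every sequence $(I_n)$ of elements of $\mathcal I$ there exists $I\in\mathcal I$ such that $I_n\setminus I$ is finite for all $n$. A sequence $(x_n)$ in a topological space $\mathcal I$-converges to $x$ if $\{n\in\mathbb N_0: x_n\notin U\}\in\mathcal I$ for every neighborhood $U$ of $x$. A sequence $\mathbf v$ in $G$ (possibly indexed by an infinite subset of $\mathbb N_0$, enumerated increasingly) is a $T$-sequence if there is a Hausdorff group topology on $G$ in which $\mathbf v$ converges to $0$; $T_{\mathbf v}$ is then the finest such topology. A sequence $\mathbf u=(u_n)_{n\in\mathbb N_0}$ in $G$ is a $T^{\mathcal I}$-sequence if there is a Hausdorff group topology on $G$ in which $\mathbf u$ $\mathcal I$-converges to $0$; $T^{\mathcal I}_{\mathbf u}$ is then the finest such topology (the supremum of all of them). *)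

(* Defs.v *)
From HB Require Import structures.
From mathcomp Require Import all_boot all_order all_algebra.
From mathcomp Require Import all_classical topology.
Set Implicit Arguments.
Unset Strict Implicit.
Unset Printing Implicit Defensive.
Import GRing.Theory.
Local Open Scope classical_set_scope.
Local Open Scope ring_scope.

Definition is_ideal (I : set_system nat) :=
  [/\ I !=set0,
      (forall A B : set nat, B `<=` A -> I A -> I B) &
      (forall A B : set nat, I A -> I B -> I (A `|` B))].

Definition is_free_ideal (I : set_system nat) := forall A, finite_set A -> I A.

Definition is_proper_ideal (I : set_system nat) := I <> setT.

Definition is_P_ideal (I : set_system nat) :=
  forall F : nat -> set nat, (forall n, I (F n)) ->
  exists2 A, I A & forall n, finite_set (F n `\` A).

Definition ideal_cvg (I : set_system nat) (T : topologicalType)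
  (x : nat -> T) (l : T) := forall U, nbhs l U -> I [set n | ~ U (x n)].

(* The strictly increasing enumeration of an infinite set [A] of natural
   numbers; it is the junk value [id] when [A] is finite. *)
Definition incr_enum (A : set nat) : nat -> nat :=
  xget (id : nat -> nat) [set e : nat -> nat | {homo e : m n / (m < n)%N} /\ range e = A].

(* The sequence (u_n)_{n in A}, for [A] infinite. *)
Definition subsequence (T : Type) (u : nat -> T) (A : set nat) : nat -> T :=
  u \o incr_enum A.

(* Since several topologies on the same group are compared, a topology on [G]
   is an inhabitant of the class [Topological G] of topological structures on
   the carrier [G], and [G @@ tau] is the corresponding space (G, tau). *)
Notation "G @@ tau" := (@Topological.Pack G tau : topologicalType)
  (at level 20).

Section GroupTopologies.
Variable G : zmodType.
Implicit Types (tau : Topological G) (P : set (Topological G)).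

Definition group_topology tau :=
  continuous (fun x : (G @@ tau) * (G @@ tau) =>
    ((x.1 : G) + (x.2 : G) : G @@ tau)) /\
  continuous (fun x : G @@ tau => (- (x : G) : G @@ tau)).

Definition hausdorff_group_topology tau :=
  group_topology tau /\ hausdorff_space (G @@ tau).

Definition sup_of P : Topological G :=
  Topological.class (sup_topology (fun t : {tau | P tau} => sval t)).

Definition cvg0 tau (v : nat -> G) :=
  (v : nat -> G @@ tau) @ \oo --> ((0 : G) : G @@ tau).

Definition ideal_cvg0 I tau (u : nat -> G) :=
  ideal_cvg I (u : nat -> G @@ tau) ((0 : G) : G @@ tau).

Definition T_sequence (v : nat -> G) :=
  exists tau, hausdorff_group_topology tau /\ cvg0 tau v.

Definition T_topology (v : nat -> G) : Topological G :=
  sup_of [set tau | hausdorff_group_topology tau /\ cvg0 tau v].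

Definition TI_sequence I (u : nat -> G) :=
  exists tau, hausdorff_group_topology tau /\ ideal_cvg0 I tau u.

Definition TI_topology I (u : nat -> G) : Topological G :=
  sup_of [set tau | hausdorff_group_topology tau /\ ideal_cvg0 I tau u].

Definition opens tau : set_system G := @open (G @@ tau).

End GroupTopologies.

Section Soundness.
Variable G : zmodType.
Implicit Types (tau : Topological G) (P : set (Topological G)).

Lemma sup_of_cvg P (F : set_system G) {FF : Filter F} (x : G) :
  F --> (x : G @@ sup_of P) <-> forall tau, P tau -> F --> (x : G @@ tau).
Proof.
split=> [h tau Pt|h]; last by apply/cvg_sup => -[tau Pt]; exact: h.
by have /cvg_sup /(_ (exist _ tau Pt)) := h.
Qed.

Lemma sup_of_ub P tau : P tau -> continuous (id : G @@ sup_of P -> G @@ tau).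
Proof.
move=> Pt x; have FF : Filter (nbhs (x : G @@ sup_of P)) by exact: nbhs_filter.
exact: ((sup_of_cvg P x).1 (fun _ => id) tau Pt).
Qed.

Arguments sup_of_ub {P tau} _ _ _ _.

Lemma sup_of_group P : (forall tau, P tau -> group_topology tau) ->
  group_topology (sup_of P).
Proof.
move=> h; split=> x.
  have xF : Filter (nbhs (x : (G @@ sup_of P) * (G @@ sup_of P))).
    exact: nbhs_filter.
  apply/(@sup_of_cvg _ _ (fmap_filter _ xF)) => tau Pt; have [ha _] := h _ Pt.
  apply: (@continuous2_cvg _ (G @@ tau) (G @@ tau) (G @@ tau) _ xF fst snd
    (fun a b => (a : G) + (b : G)) x.1 x.2); first exact: (ha (x.1, x.2)).
    by move=> U /(sup_of_ub Pt x.1); exact: cvg_fst.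
  by move=> U /(sup_of_ub Pt x.2); exact: cvg_snd.
have xF : Filter (nbhs (x : G @@ sup_of P)) by exact: nbhs_filter.
apply/(@sup_of_cvg _ _ (fmap_filter _ xF)) => tau Pt; have [_ ho] := h _ Pt.
exact: (cvg_comp _ _ (sup_of_ub Pt x) (ho x)).
Qed.

Lemma sup_of_hausdorff P tau : P tau -> hausdorff_space (G @@ tau) ->
  hausdorff_space (G @@ sup_of P).
Proof.
move=> Pt hT p q pq; apply: hT => A B pA qB.
by apply: pq; apply: (sup_of_ub Pt).
Qed.

Lemma sup_of_ideal_cvg0 I P u : is_ideal I ->
  (forall tau, P tau -> ideal_cvg0 I tau u) -> ideal_cvg0 I (sup_of P) u.
Proof.
move=> [[A0 IA0] Isub IU] h.
have FF : Filter [set U : set G | I [set n | ~ U (u n)]].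
  split=> /=.
  - by apply: Isub IA0 => n /(_ Logic.I).
  - move=> U V hU hV; apply: Isub (IU _ _ hU hV) => n /= /not_andP.
    by case; [left|right].
  - by move=> U V UV; apply: Isub => n /= + /UV.
by apply/sup_of_cvg => tau Pt U; apply: h.
Qed.

Lemma T_topologyP (v : nat -> G) : T_sequence v ->
  [/\ hausdorff_group_topology (T_topology v), cvg0 (T_topology v) v &
      forall tau, hausdorff_group_topology tau -> cvg0 tau v ->
        opens tau `<=` opens (T_topology v)].
Proof.
move=> [t0 [[gt0 ht0] ct0]]; split.
- split; first by apply: sup_of_group => tau [[]].
  by apply: (@sup_of_hausdorff _ t0).
- by apply/sup_of_cvg => tau [].
- move=> tau ht ct; have /continuousP := sup_of_ub (conj ht ct : [set tau |
    hausdorff_group_topology tau /\ cvg0 tau v] tau).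
  by move=> h U /h.
Qed.

Lemma TI_topologyP I (u : nat -> G) : is_ideal I -> TI_sequence I u ->
  [/\ hausdorff_group_topology (TI_topology I u),
      ideal_cvg0 I (TI_topology I u) u &
      forall tau, hausdorff_group_topology tau -> ideal_cvg0 I tau u ->
        opens tau `<=` opens (TI_topology I u)].
Proof.
move=> hI [t0 [[gt0 ht0] ct0]]; split.
- split; first by apply: sup_of_group => tau [[]].
  by apply: (@sup_of_hausdorff _ t0).
- by apply: sup_of_ideal_cvg0 => // tau [].
- move=> tau ht ct; have /continuousP := sup_of_ub (conj ht ct : [set tau |
    hausdorff_group_topology tau /\ ideal_cvg0 I tau u] tau).
  by move=> h U /h.
Qed.

End Soundness.

Lemma incr_enumP (A : set nat) : infinite_set A ->
  {homo incr_enum A : m n / (m < n)%N} /\ range (incr_enum A) = A.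
Proof.
move=> Ainf.
have next n : exists m, `[< A m >] && (n <= m)%N.
  apply: contrapT => h; apply: Ainf; apply: (sub_finite_set _ (finite_II n)).
  move=> m Am; rewrite /= ltnNge; apply/negP => nm; apply: h; exists m.
  by rewrite nm andbT; apply/asboolP.
pose e := fix e k := if k is k'.+1 then ex_minn (next (e k').+1)
                     else ex_minn (next 0%N).
have eS k : (e k < e k.+1)%N by rewrite /=; case: ex_minnP => m /andP[].
have eincr : {homo e : m n / (m < n)%N} by apply: homo_ltn => //; exact: ltn_trans.
suff ex : exists e0 : nat -> nat,
    {homo e0 : m n / (m < n)%N} /\ range e0 = A.
  exact: (@xgetPex _ (id : nat -> nat) _ ex).
exists e; split=> //; apply/seteqP; split=> [_ [k _ <-]|a Aa].
  by case: k => [|k] /=; case: ex_minnP => m /andP[/asboolP].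
apply: contrapT => ne; suff /(_ a.+1) : forall k, (e k < a)%N.
  have le k : (k <= e k)%N.
    by elim: k => // k; move/leq_ltn_trans; apply.
  by move=> lt; have := leq_trans (le a.+1) (ltnW lt); rewrite ltnn.
have nea k : e k != a by apply/eqP => ek; apply: ne; exists k.
elim=> [|k ih]; rewrite ltn_neqAle nea /=; case: ex_minnP => m _ h.
  by apply: h; rewrite andbT; apply/asboolP.
by apply: h; rewrite ih andbT; apply/asboolP.
Qed.

(* Main.v *)
(* If u I-converges to 0 in a Hausdorff group topology and I is a P-ideal, the
   topology need not be first countable, so one first passes to the countable
   subgroup H generated by the u_n: choosing neighbourhoods U_k of 0 with
   U_(k+1) - U_(k+1) in U_k, with U_(k+1) missing the k-th element of H (when
   nonzero), the sets U_k `&` H are a neighbourhood base at 0 of a first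
   countable Hausdorff group topology on G, in which H is open and u still
   I-converges to 0. A pseudo-union in I of the exceptional sets of this base is
   then the required set A. *)
From HB Require Import structures.
Require Import Defs.
From mathcomp Require Import all_boot all_order all_algebra.
From mathcomp Require Import all_classical topology.
Local Open Scope classical_set_scope.
Import GRing.Theory.
Local Open Scope ring_scope.

(** * Group topologies defined by a sequence of sets around 0 *)

Section SequenceBase.
Variables (G : zmodType) (V : nat -> set G).
Hypothesis V0 : forall n, V n 0.
Hypothesis VB : forall n a b, V n.+1 a -> V n.+1 b -> V n (a - b).

Lemma base_le m n : (m <= n)%N -> V n `<=` V m.
Proof.
move=> /subnK <-; elim: (n - m)%N => // k ih x Vx.
by apply: ih; rewrite -[x]subr0; apply: VB.
Qed.

Lemma baseN n a : V n.+1 a -> V n (- a).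
Proof. by move=> Va; rewrite -sub0r; apply: VB. Qed.

(** [VB] only controls differences: rewriting a sum as [a - (- b)] costs one index for the negation
    and one for the subtraction. *)
Lemma baseD n a b : V n.+2 a -> V n.+2 b -> V n (a + b).
Proof.
move=> Va Vb; rewrite -[b]opprK; apply: VB; last exact: baseN.
exact: base_le Va.
Qed.

Definition base_nbhs (x : G) : set_system G :=
  [set U | exists n, forall v, V n v -> U (x + v)].

Lemma base_nbhs_filter x : ProperFilter (base_nbhs x).
Proof.
split.
  by move=> [n /(_ 0 (V0 n))].
split.
- by exists 0%N.
- move=> A B [m Am] [n Bn]; exists (maxn m n) => v Vv; split.
    by apply: Am; apply: base_le Vv; rewrite leq_maxl.
  by apply: Bn; apply: base_le Vv; rewrite leq_maxr.
- by move=> A B AB [n An]; exists n => v /An /AB.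
Qed.

Lemma base_nbhs_singleton x (A : set G) : base_nbhs x A -> A x.
Proof. by move=> [n /(_ 0 (V0 n))]; rewrite addr0. Qed.

Lemma base_nbhs_nbhs x (A : set G) :
  base_nbhs x A -> base_nbhs x (base_nbhs^~ A).
Proof.
move=> [n An]; exists n.+2 => v Vv; exists n.+2 => w Vw.
by rewrite -addrA; apply/An/baseD.
Qed.

(** A fresh name for the carrier, so that the instances attach to it and not to [G] itself. *)
Definition base_space : Type := G.
HB.instance Definition _ := Choice.on base_space.
HB.instance Definition _ := hasNbhs.Build base_space base_nbhs.
HB.instance Definition _ := Nbhs_isNbhsTopological.Build base_space
  base_nbhs_filter base_nbhs_singleton base_nbhs_nbhs.

Definition base_topology : Topological G := Topological.class base_space.

Lemma base_topology_nbhs (x : G) (U : set G) :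
  nbhs (x : G @@ base_topology) U <-> exists n, forall v, V n v -> U (x + v).
Proof. by []. Qed.

Lemma base_topology_group : group_topology base_topology.
Proof.
split=> x U /base_topology_nbhs [n Un].
  exists ([set y | exists2 v, V n.+2 v & y = x.1 + v],
          [set y | exists2 v, V n.+2 v & y = x.2 + v]).
    by split; apply/base_topology_nbhs; exists n.+2 => v Vv; exists v.
  move=> [_ _] [/= [v Vv ->] [w Vw ->]].
  by rewrite /= addrACA; apply/Un/baseD.
apply/base_topology_nbhs; exists n.+1 => v /baseN Vv /=.
by rewrite opprD; apply: Un.
Qed.

Lemma base_topology_hausdorff : (forall x, (forall n, V n x) -> x = 0) ->
  hausdorff_space (G @@ base_topology).
Proof.
move=> VI p q pq; apply/(@subr0_eq G)/VI => n.
have nb x : nbhs (x : G @@ base_topology) [set y | V n.+1 (y - x)].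
  by apply/base_topology_nbhs; exists n.+1 => v Vv /=; rewrite addrC addKr.
have [y [/= yp yq]] := pq _ _ (nb p) (nb q).
have -> : p - q = (y - q) - (y - p) :> G.
  by rewrite opprB [RHS]addrC -addrA [- y + _]addrA addNr add0r.
exact: VB.
Qed.

End SequenceBase.

(** * Countable bases inside the generated subgroup *)

Lemma hausdorff_nbhs0 (G : zmodType) (tau : Topological G) (V : set G) (h : G) :
  hausdorff_group_topology tau -> nbhs (0 : G @@ tau) V ->
  exists W : set G, [/\ nbhs (0 : G @@ tau) W, h <> 0 -> ~ W h &
    forall a b, W a -> W b -> V (a - b)].
Proof.
move=> [[tD tN] tH] V0.
have [W1 W1_0 W1h] : exists2 W : set G, nbhs (0 : G @@ tau) W & h <> 0 -> ~ W h.
  apply: contrapT => hW; have h0 : h <> 0.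
    by move=> h0; apply: hW; exists V.
  (* If every neighbourhood of 0 contained [h], then [h] itself would witness that 0 and [h] cannot
     be separated. *)
  apply: h0; apply/esym/tH => A B A0 Bh; exists h; split; last exact: (@nbhs_singleton (G @@ tau)).
  by apply: contrapT => Ah; apply: hW; exists A.
have : nbhs ((0, 0) : (G @@ tau) * (G @@ tau)) [set x | V ((x.1 : G) + x.2)].
  by apply: tD => /=; rewrite addr0.
move=> [[A B] /= [A0 B0] AB].
have NB0 : nbhs (0 : G @@ tau) [set x : G | B (- x)].
  by apply: (tN (0 : G)); rewrite /= oppr0.
exists (W1 `&` (A `&` [set x : G | B (- x)])); split.
- by apply: filterI => //; apply: filterI.
- by move=> /W1h nW [].
- by move=> a b [_ [Aa _]] [_ [_ Bb]]; apply: (AB (a, - b)).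
Qed.

Section GeneratedSubgroup.
Variables (G : zmodType) (u : nat -> G).

(** Its range is the subgroup generated by [u]; the codes [s] form a countable type, so [pickle]
    numbers the elements. *)
Definition int_comb (s : seq (nat * int)) : G := \sum_(p <- s) u p.1 *~ p.2.

Lemma int_combB s t : int_comb s - int_comb t =
  int_comb (s ++ [seq (p.1, - p.2) | p <- t]).
Proof.
rewrite /int_comb big_cat big_map /= -sumrN; congr (_ + _).
by apply: eq_bigr => p _; rewrite mulrNz.
Qed.

Lemma int_comb0 : int_comb [::] = 0.
Proof. by rewrite /int_comb big_nil. Qed.

Lemma int_comb1 n : int_comb [:: (n, 1)] = u n.
Proof. by rewrite /int_comb big_seq1. Qed.

End GeneratedSubgroup.

Arguments int_comb {G} u s.

(** The sets [V n] lie in the subgroup and need not be [tau]-neighbourhoods of 0; the last clause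
    recovers what is needed of them along [u]. *)
Lemma countable_base (G : zmodType) (tau : Topological G) (u : nat -> G) :
  hausdorff_group_topology tau ->
  exists V : nat -> set G, [/\ forall n, V n 0,
    forall n a b, V n.+1 a -> V n.+1 b -> V n (a - b),
    forall x, (forall n, V n x) -> x = 0 &
    forall n, exists2 U : set G, nbhs (0 : G @@ tau) U &
      forall k, U (u k) -> V n (u k)].
Proof.
move=> ht.
have step (p : nat * set G) : exists W : set G, nbhs (0 : G @@ tau) p.2 ->
    [/\ nbhs (0 : G @@ tau) W,
      forall s, unpickle p.1 = Some s -> int_comb u s <> 0 -> ~ W (int_comb u s) &
      forall a b, W a -> W b -> p.2 (a - b)].
  (* Choice needs a total function, hence the arbitrary [setT]; likewise the element 0 below, for an
     index that decodes to nothing, makes the avoidance clause vacuous. *)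
  have [p0|np0] := pselect (nbhs (0 : G @@ tau) p.2); last by exists setT.
  have [W [W0 Wh WB]] := hausdorff_nbhs0 _ _ _
    (if unpickle p.1 is Some s then int_comb u s else 0) ht p0.
  by exists W => _; split=> // s sE; move: Wh; rewrite sE.
have [next nextP] := choice step.
pose U := fix U k : set G := if k is k'.+1 then next (k', U k') else setT.
have U0 k : nbhs (0 : G @@ tau) (U k).
  by elim: k => [|k ih]; [exact: filterT | have [] := nextP (k, U k) ih].
pose H := range (int_comb u).
exists (fun n => U n `&` H); split.
- by move=> n; split; [exact: (@nbhs_singleton (G @@ tau)) (U0 n) | exists [::]; rewrite ?int_comb0].
- move=> n a b [Ua [s _ sa]] [Ub [t _ tb]]; split.
    by have [_ _] := nextP (n, U n) (U0 n); apply.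
  by rewrite -sa -tb int_combB; eexists.
(* Membership in [V 0] gives [x] a code [s]; a nonzero [x] is excluded at stage [(pickle s).+1]. *)
- move=> x Vx; have [_ [s _ sx]] := Vx 0%N; apply: contrapT => x0.
  have [_ + _] := nextP (pickle s, U (pickle s)) (U0 _).
  move=> /(_ s (pickleK s)); rewrite sx => /(_ x0); apply.
  by have [] := Vx (pickle s).+1.
- move=> n; exists (U n) => // k Uk; split=> //.
  by exists [:: (k, 1)]; rewrite ?int_comb1.
Qed.

(** * Ideal convergence against convergence off a set of the ideal *)

Lemma ideal_compl_infinite (I : set_system nat) (A : set nat) :
  is_ideal I -> is_proper_ideal I -> is_free_ideal I -> I A ->
  infinite_set (~` A).
Proof.
move=> [_ Isub IU] Ip If IA fA; apply: Ip; apply/seteqP; split=> // B _.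
by apply: Isub (IU _ _ IA (If _ fA)); rewrite setUv.
Qed.

Lemma leq_homo_ltn (e : nat -> nat) :
  {homo e : m n / (m < n)%N} -> forall n, (n <= e n)%N.
Proof. by move=> eh; elim=> // n /leq_ltn_trans; apply; apply: eh. Qed.

(** The exceptional indices lie in [A] or among the first [N] elements of its complement. *)
Lemma cvg0_ideal_cvg0 (I : set_system nat) (G : zmodType) (u : nat -> G)
    (tau : Topological G) (A : set nat) :
  is_ideal I -> is_free_ideal I -> I A -> infinite_set (~` A) ->
  cvg0 tau (subsequence u (~` A)) -> ideal_cvg0 I tau u.
Proof.
move=> [_ Isub IU] If IA Ainf cu U /cu [N _ NU].
have [_ eA] := incr_enumP Ainf.
apply: Isub (IU _ _ IA (If _ (finite_image (incr_enum (~` A)) (finite_II N)))).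
move=> n /= nU; have [An|nAn] := pselect (A n); first by left.
right; have [k _ kn] : range (incr_enum (~` A)) n by rewrite eA.
exists k => //=; rewrite ltnNge; apply/negP => Nk; apply: nU.
by have := NU k Nk; rewrite /= /subsequence /= kn.
Qed.

Lemma TI_sequence_T_sequence (I : set_system nat) (G : zmodType) (u : nat -> G) :
  is_ideal I -> is_proper_ideal I -> is_free_ideal I -> is_P_ideal I ->
  TI_sequence I u ->
  exists A : set nat, I A /\ T_sequence (subsequence u (~` A)).
Proof.
move=> hI Ip If IP [tau [ht cu]].
have [V [V0 VB VI VU]] := countable_base G tau u ht.
have IF n : I [set k | ~ V n (u k)].
  have [U U0 UV] := VU n; have [_ Isub _] := hI.
  by apply: Isub (cu U U0) => k /= nV /UV.
have [A IA fA] := IP _ IF; exists A; split=> //.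
exists (base_topology G V V0 VB); split.
  by split; [exact: base_topology_group | exact: base_topology_hausdorff].
move=> U /base_topology_nbhs [n nU].
have [eh eA] := incr_enumP (ideal_compl_infinite I A hI Ip If IA).
have [N FN] : exists N, forall k, ([set k | ~ V n (u k)] `\` A) k -> (k < N)%N.
  have /finite_seqP [s sE] := fA n; exists (\max_(k <- s) k).+1 => k.
  by rewrite sE ltnS /= => ks; exact: (@leq_bigmax_seq _ s xpredT id).
exists N => // k /= Nk; rewrite -[subsequence _ _ _]add0r; apply: nU.
apply: contrapT => nV.
have : (incr_enum (~` A) k < N)%N.
  by apply: FN; split=> //; have : range (incr_enum (~` A)) (incr_enum (~` A) k);
    [exists k | rewrite eA].
by rewrite ltnNge (leq_trans Nk (leq_homo_ltn _ eh k)).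
Qed.

Local Close Scope ring_scope.

Theorem lemma5p2 (I : set_system nat) (hI : is_ideal I) (Iproper : is_proper_ideal I)
    (Ifree : is_free_ideal I) (G : zmodType) (u : nat -> G) :
  (forall (tau : Topological G) (A : set nat),
     hausdorff_group_topology tau -> I A -> cvg0 tau (subsequence u (~` A)) ->
     [/\ TI_sequence I u,
         continuous (id : G @@ TI_topology I u -> G @@ tau) &
         opens (T_topology (subsequence u (~` A))) `<=` opens (TI_topology I u)])
  /\
  (is_P_ideal I ->
     (TI_sequence I u <->
        exists A : set nat, I A /\ T_sequence (subsequence u (~` A))) /\
     (forall A : set nat, I A -> T_sequence (subsequence u (~` A)) ->
        continuous (id : G @@ TI_topology I u ->
                         G @@ T_topology (subsequence u (~` A))))).
Proof.
have cvgI tau A : hausdorff_group_topology tau -> I A ->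
    cvg0 tau (subsequence u (~` A)) -> ideal_cvg0 I tau u.
  move=> ht IA; apply: cvg0_ideal_cvg0 => //.
  exact: ideal_compl_infinite hI Iproper Ifree IA.
have cont tau A : hausdorff_group_topology tau -> I A ->
    cvg0 tau (subsequence u (~` A)) ->
    continuous (id : G @@ TI_topology I u -> G @@ tau).
  by move=> ht IA cu; apply: sup_of_ub; split=> //; apply: cvgI cu.
(* [T_topology] is itself a Hausdorff group topology in which the subsequence tends to 0, so [cont]
   applies to it. *)
have contT A : I A -> T_sequence (subsequence u (~` A)) ->
    continuous (id : G @@ TI_topology I u ->
                     G @@ T_topology (subsequence u (~` A))).
  by move=> IA /T_topologyP [hT cT _]; apply: cont cT.
split=> [tau A ht IA cu|IP].
  split; first by exists tau; split=> //; apply: cvgI cu.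
    exact: cont cu.
  have Tu : T_sequence (subsequence u (~` A)) by exists tau.
  by have /continuousP h := contT A IA Tu; move=> U /h.
split=> //; split; first exact: TI_sequence_T_sequence.
by move=> [A [IA [tau [ht cu]]]]; exists tau; split=> //; apply: cvgI cu.
Qed.
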